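(* Let $n$ be a positive integer and let $A_1,\dots,A_n$ be real symmetric positive semidefinite matrices of the same size such that $A_1+\dots+A_n\preceq nI$. Then $$-n(n-1)I\preceq\sum_{i\neq j}A_iA_j\preceq n(n-1)I,$$ where the sum is over all ordered pairs $(i,j)$ with $1\le i,j\le n$ and $i\ne j$.
   Context: For real symmetric matrices $A,B$ of the same size, $A\preceq B$ (Loewner order) means that $B-A$ is positive semidefinite. $I$ is the identity matrix. *)

(* Defs.v *)
From HB Require Import structures.
From mathcomp Require Import all_boot all_order all_algebra.
From mathcomp Require Import reals.
Set Implicit Arguments.
Unset Strict Implicit.
Unset Printing Implicit Defensive.
Import Order.TTheory GRing.Theory Num.Theory.
Local Open Scope ring_scope.

Definition psdmx (R : realType) (m : nat) (A : 'M[R]_m) : Prop :=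
  A \is symmetricmx /\ forall x : 'cV[R]_m, 0 <= (x^T *m A *m x) 0 0.

(* Symmetry is required only of the difference B - A; when one of A, B is
   symmetric, this forces the other to be symmetric as well. *)
Definition loewner_le (R : realType) (m : nat) (A B : 'M[R]_m) : Prop :=
  psdmx (B - A).

(* Main.v *)
Require Import Defs.
From HB Require Import structures.
From mathcomp Require Import all_boot all_order all_algebra.
From mathcomp Require Import ring lra.
From mathcomp Require Import reals.
Import Order.TTheory GRing.Theory Num.Theory.
Local Open Scope ring_scope.

(** Write S for the sum of the A_i, so that the sum over i <> j is
    S^2 - \sum_i A_i^2.  If X is positive semidefinite and X <= c I with c > 0,
    then X^2 <= c X; this applies to S and to each A_i <= S with c = n.
    Upper bound: \sum_i A_i^2 >= S^2 / n (the matrices A_i - S / n have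
    positive semidefinite squares) and S^2 <= n S <= n^2 I.
    Lower bound: \sum_i A_i^2 <= n S, hence
    S^2 - \sum_i A_i^2 >= S^2 - n S >= - (n^2 / 4) I, and n^2 / 4 <= n (n - 1)
    as soon as n >= 2; for n = 1 the sum is empty. *)

Section PsdMatrices.
Context {R : realType} {m : nat}.
Implicit Types (A B : 'M[R]_m) (c : R).

Lemma symmetricmxE A : (A \is symmetricmx) = (A == A^T).
Proof. by rewrite is_hermitianmxE expr0 scale1r map_mx_id. Qed.

Lemma psdmx_tr {A} : psdmx A -> A^T = A.
Proof. by case; rewrite symmetricmxE => /eqP. Qed.

Lemma psdmx0 : psdmx (0 : 'M[R]_m).
Proof.
split=> [|x]; first by rewrite symmetricmxE trmx0.
by rewrite mulmx0 mul0mx mxE.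
Qed.

Lemma psdmxD {A B} : psdmx A -> psdmx B -> psdmx (A + B).
Proof.
move=> psdA psdB; split=> [|x].
  by rewrite symmetricmxE raddfD /= !psdmx_tr.
by rewrite mulmxDr mulmxDl mxE addr_ge0 //; [case: psdA | case: psdB].
Qed.

Lemma psdmx_sum (I : Type) (r : seq I) (P : pred I) (F : I -> 'M[R]_m) :
  (forall i, P i -> psdmx (F i)) -> psdmx (\sum_(i <- r | P i) F i).
Proof. exact: (big_ind _ psdmx0 (@psdmxD)). Qed.

Lemma psdmxZ {c A} : 0 <= c -> psdmx A -> psdmx (c *: A).
Proof.
move=> c0 psdA; split=> [|x]; first by rewrite symmetricmxE linearZ /= psdmx_tr.
by rewrite -scalemxAr -scalemxAl mxE mulr_ge0 //; case: psdA.
Qed.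

Lemma psdmx1 : psdmx (1%:M : 'M[R]_m).
Proof.
split=> [|x]; first by rewrite symmetricmxE trmx1.
rewrite mulmx1 mxE sumr_ge0 // => i _.
by rewrite mxE -expr2 sqr_ge0.
Qed.

Lemma psdmx_congr {A} B : psdmx A -> psdmx (B^T *m A *m B).
Proof.
move=> psdA; split=> [|x].
  by rewrite symmetricmxE !trmx_mul trmxK (psdmx_tr psdA) mulmxA.
case: psdA => _ /(_ (B *m x)); by rewrite trmx_mul !mulmxA.
Qed.

Lemma psdmx_sqr A : A^T = A -> psdmx (A *m A).
Proof. by move=> trA; have := psdmx_congr A psdmx1; rewrite trA mulmx1. Qed.

(** With B = c I - A, both A B and B A equal c A - A^2, and A + B = c I. Hence B A B + A B A = (A +
    B) A B = c (c A - A^2), and both terms on the left are congruences of positive semidefinite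
    matrices. *)
Lemma loewner_sqr_le c A :
  0 < c -> psdmx A -> loewner_le A c%:M -> loewner_le (A *m A) (c *: A).
Proof.
rewrite /loewner_le => c_gt0 psdA psdB; set B := c%:M - A in psdB.
have -> : c *: A - A *m A = c^-1 *: (B^T *m A *m B + A^T *m B *m A).
  have AB : A *m B = c *: A - A *m A by rewrite mulmxBr mul_mx_scalar.
  have BA : B *m A = c *: A - A *m A by rewrite mulmxBl mul_scalar_mx.
  rewrite !psdmx_tr // -[B *m A *m B]mulmxA -[A *m B *m A]mulmxA AB BA -AB.
  by rewrite -mulmxDl subrK mul_scalar_mx scalerA mulVf ?gt_eqF ?scale1r.
apply: psdmxZ; first by rewrite invr_ge0 ltW.
by apply: psdmxD; apply: psdmx_congr.
Qed.

Lemma sqr_sum_diag (n : nat) (A : 'I_n -> 'M[R]_m) :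
  \sum_(p : 'I_n * 'I_n | p.1 != p.2) A p.1 *m A p.2 =
  (\sum_i A i) *m (\sum_i A i) - \sum_i A i *m A i.
Proof.
apply/esym/eqP; rewrite subr_eq; apply/eqP.
rewrite mulmx_suml.
under eq_bigr => i _ do rewrite mulmx_sumr (bigD1 i) //=.
rewrite big_split /= addrC; congr (_ + _).
rewrite pair_big_dep /=; apply: eq_bigl => -[i j] /=.
by rewrite eq_sym.
Qed.

End PsdMatrices.

Theorem theorem1 (R : realType) (n m : nat) (A : 'I_n -> 'M[R]_m)
    (n_gt0 : (0 < n)%N)
    (A_psd : forall i : 'I_n, psdmx (A i))
    (sumA_le : loewner_le (\sum_(i < n) A i) (n%:R)%:M) :
  loewner_le (- (n%:R * (n%:R - 1))%:M)
             (\sum_(p : 'I_n * 'I_n | p.1 != p.2) A p.1 *m A p.2)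
  /\
  loewner_le (\sum_(p : 'I_n * 'I_n | p.1 != p.2) A p.1 *m A p.2)
             (n%:R * (n%:R - 1))%:M.
Proof.
have N_gt0 : 0 < n%:R :> R by rewrite ltr0n.
have N_neq0 : n%:R != 0 :> R by rewrite gt_eqF.
have N_ge1 : 1 <= n%:R :> R by rewrite ler1n.
set S := \sum_i A i in sumA_le *.
have S_psd : psdmx S by apply: psdmx_sum.
have S_sqr : loewner_le (S *m S) (n%:R *: S) by apply: loewner_sqr_le.
have A_sqr i : psdmx (n%:R *: A i - A i *m A i).
  apply: loewner_sqr_le => //; rewrite /loewner_le.
  (* A_i <= n I, because A_i differs from S by the sum of the other A_j. *)
  have -> : n%:R%:M - A i = (n%:R%:M - S) + \sum_(j | j != i) A j.
    by rewrite [S](bigD1 i) //= opprD addrA subrK.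
  by apply: psdmxD => //; apply: psdmx_sum.
have lower : psdmx (n%:R *: S - \sum_i A i *m A i).
  by rewrite scaler_sumr -sumrB; apply: psdmx_sum.
have upper : psdmx (\sum_i A i *m A i - n%:R^-1 *: (S *m S)).
  have -> : \sum_i A i *m A i - n%:R^-1 *: (S *m S) =
      \sum_i (A i - n%:R^-1 *: S) *m (A i - n%:R^-1 *: S).
    under [RHS]eq_bigr do
      rewrite mulmxBl !mulmxBr -!scalemxAl -!scalemxAr scalerA.
    rewrite !sumrB -!scaler_sumr -mulmx_suml -mulmx_sumr -/S.
    rewrite sumr_const card_ord -[_ *m _ *+ _]scaler_nat scalerA divfK //.
    by rewrite subrr subr0.
  apply: psdmx_sum => i _; apply: psdmx_sqr.
  by rewrite linearB linearZ /= !psdmx_tr.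
(* Completing the square: this matrix is (S - (n / 2) I)^2. *)
have center : psdmx (S *m S - n%:R *: S + (n%:R ^+ 2 / 4) *: 1%:M).
  have := psdmx_sqr (S - (n%:R / 2)%:M).
  rewrite linearB /= tr_scalar_mx psdmx_tr // => /(_ erefl).
  rewrite mulmxBl !mulmxBr !mul_scalar_mx mul_mx_scalar -scalemx1 scalerA.
  congr psdmx.
  (* Generalizing keeps [mxE] from expanding the product and the identity, so each entry is a scalar
     identity for [field]. *)
  move: (S) (S *m S) 1%:M (n%:R : R) => T P I N.
  by apply/matrixP => i j; rewrite !mxE; field.
have {}sumA_le : psdmx (n%:R *: 1%:M - S) by rewrite scalemx1.
rewrite /loewner_le -scalemx1 sqr_sum_diag -/S.
split; last first.
  (* With Q the sum of the A_i^2, n (n - 1) I - (S^2 - Q) equals (1 - 1/n) (n (n I - S) + (n S -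
     S^2)) + (Q - S^2 / n). *)
  have N_inv : 0 <= 1 - n%:R^-1 :> R by rewrite subr_ge0 invf_le1.
  have S_sqr_le := psdmxD (psdmxZ (ltW N_gt0) sumA_le) S_sqr.
  have := psdmxD (psdmxZ N_inv S_sqr_le) upper; congr psdmx.
  move: (S) (S *m S) (\sum_i _) 1%:M (n%:R : R) N_neq0.
  move=> T P Q I N N_neq0.
  by apply/matrixP => i j; rewrite !mxE; field.
have [n_le1|n_gt1] := leqP n 1.
  rewrite -sqr_sum_diag big1 => [|[i j] /=].
    have -> : n = 1%N by apply/eqP; rewrite eqn_leq n_le1.
    have -> : 1%:R * (1%:R - 1) = 0 :> R by rewrite subrr mulr0.
    by rewrite scale0r oppr0 subr0; apply: psdmx0.
  case/negP; apply/eqP/val_inj => /=.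
  have ord_eq0 (k : 'I_n) : k = 0%N :> nat.
    by apply/eqP; rewrite -leqn0 -ltnS (leq_trans (ltn_ord k)).
  by rewrite !ord_eq0.
have N_ge2 : 2 <= n%:R :> R by rewrite ler_nat.
(* This is the slack n (n - 1) - n^2 / 4; it is negative at n = 1, hence the separate case. *)
have N_quad : 0 <= 3 / 4 * n%:R ^+ 2 - n%:R :> R by nra.
(* The terms n S of [center] and [lower] cancel, leaving S^2 - Q + n (n - 1) I. *)
have := psdmxD (psdmxD center lower) (psdmxZ N_quad psdmx1).
congr psdmx.
move: (S) (S *m S) (\sum_i _) 1%:M (n%:R : R) => T P Q I N.
by apply/matrixP => i j; rewrite !mxE; field.
Qed.
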